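(* The Shapley value of parking games is not (in general) a least core allocation: there exist a positive integer $n$ and a parking function $\alpha\in \mathrm{PF}_n$ such that the Shapley value $(\phi_1(c_\alpha),\dots,\phi_n(c_\alpha))$ of the parking game $c_\alpha$ does not belong to the least core of $c_\alpha$.
   Context: Write $[k]=\{1,\dots,k\}$; $\mathfrak{S}_n$ is the symmetric group on $[n]$. Parking process: there is a one-way street with $m$ spots numbered $1,\dots,m$, and $k\le m$ cars $1,\dots,k$ arrive one at a time in this order, with preferences $\beta=(b_1,\dots,b_k)\in[m]^k$. Upon arrival, car $i$ parks in the first unoccupied spot at or past $b_i$, if one exists; otherwise the process fails. $\mathrm{PF}_{k,m}\subseteq[m]^k$ is the set of tuples for which all cars are able to park, and $\mathrm{PF}_n=\mathrm{PF}_{n,n}$. For $\beta\in \mathrm{PF}_{k,m}$, with car $i$ parking in spot $p_i$, the total displacement is $d(\beta)=\sum_{i=1}^k(p_i-b_i)$ (and $0$ for the empty tuple); it does not depend on the order of the entries of $\beta$. Parking game: for $\alpha=(a_1,\dots,a_n)\in \mathrm{PF}_n$, $c_\alpha(S)=d((a_i:i\in S))$ for $S\subseteq[n]$, where $(a_i:i\in S)\in \mathrm{PF}_{|S|,n}$. Shapley value: for a function $c$ from subsets of $[n]$ to $\mathbb{R}$ with $c(\emptyset)=0$, $$\phi_i(c)=\frac{1}{n!}\sum_{\pi\in\mathfrak{S}_n}\Big(c(\{j\in[n]:\pi(j)\le\pi(i)\})-c(\{j\in[n]:\pi(j)<\pi(i)\})\Big),\quad i\in[n].$$ Least core: the least core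 value of $c$ is $$z^*=\min\Big\{z:\ \sum_{i=1}^n\phi_i=c([n]),\ \sum_{i\in S}\phi_i\le c(S)+z\ \text{for all }S\subseteq[n]\Big\},$$ the minimum being over $z\in\mathbb{R}$ and $\phi\in\mathbb{R}^n$. The least core of $c$ is the set of optimal solutions, i.e. the set of $\phi\in\mathbb{R}^n$ with $\sum_{i=1}^n\phi_i=c([n])$ and $\sum_{i\in S}\phi_i\le c(S)+z^*$ for all $S\subseteq[n]$; its elements are the least core allocations. *)

(* Defs.v *)
From HB Require Import structures.
From mathcomp Require Import all_boot all_order all_algebra all_fingroup.
From mathcomp Require Import all_classical all_reals all_analysis.

Set Implicit Arguments.
Unset Strict Implicit.
Unset Printing Implicit Defensive.

Import Order.TTheory GRing.Theory Num.Theory.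
Import numFieldNormedType.Exports.

Local Open Scope ring_scope.

(* Spots are the natural numbers 1, ..., m. *)
Definition first_free (m : nat) (occ : seq nat) (b : nat) : option nat :=
  ohead [seq p <- iota b (m.+1 - b) | p \notin occ].

(* [Some ps] lists the spots taken by the successive cars of [beta] when the
   spots in [occ] are already occupied; [None] means that some car cannot
   park. *)
Fixpoint park (m : nat) (occ beta : seq nat) : option (seq nat) :=
  if beta is b :: beta' then
    if first_free m occ b is Some p then
      omap (cons p) (park m (p :: occ) beta')
    else None
  else Some [::].

(* PF_{k,m} with k = size beta. *)
Definition parking_function (m : nat) (beta : seq nat) : bool :=
  all (fun b => 0 < b <= m)%N beta && park m [::] beta.

(* The natural subtraction is exact here, because a car never parks before the
   spot it prefers. The value 0 outside PF_{k,m} is a dummy: it is not used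
   below, since a subsequence of a parking function is one. *)
Definition displacement (m : nat) (beta : seq nat) : nat :=
  if park m [::] beta is Some ps then
    (\sum_(pb <- zip ps beta) (pb.1 - pb.2))%N
  else 0%N.

Lemma displacement_ex : displacement 6 [:: 2; 4; 2; 2; 1]%N = 4%N.
Proof. by rewrite /displacement /= !big_cons big_nil. Qed.

Definition parking_game (R : realType) (n : nat) (alpha : n.-tuple nat)
    (S : {set 'I_n}) : R :=
  (displacement n [seq tnth alpha i | i <- enum S])%:R.

Definition shapley (R : realType) (n : nat) (c : {set 'I_n} -> R)
    (i : 'I_n) : R :=
  (n`!%:R)^-1 *
  \sum_(pi : 'S_n) (c [set j : 'I_n | (pi j <= pi i)%N]%SET -
                    c [set j : 'I_n | (pi j < pi i)%N]%SET).

Definition least_core_feasible (R : realType) (n : nat) (c : {set 'I_n} -> R)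
    (z : R) (phi : 'I_n -> R) : Prop :=
  \sum_i phi i = c [set: 'I_n]%SET /\
  forall S : {set 'I_n}, \sum_(i in S) phi i <= c S + z.

(* This infimum is a minimum when c(set0) = 0: see [least_core_value_min]. *)
Definition least_core_value (R : realType) (n : nat)
    (c : {set 'I_n} -> R) : R :=
  inf [set z : R | exists phi, least_core_feasible c z phi]%classic.

Definition least_core (R : realType) (n : nat) (c : {set 'I_n} -> R) :
    set ('I_n -> R) :=
  [set phi | least_core_feasible c (least_core_value c) phi]%classic.

Section MinimumAttained.
Context (R : realType) (n : nat) (c : {set 'I_n} -> R).
Context (c0 : c finset.set0 = 0).
Local Open Scope classical_set_scope.

Let exc (s : seq {set 'I_n}) (v : 'rV[R]_n) : R :=
  \big[Num.max/0]_(S <- s) (\sum_(i in S) v ord0 i - c S).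

Let sum_cont (P : pred 'I_n) :
  continuous (fun v : 'rV[R]_n => \sum_(i | P i) v ord0 i : R^o).
Proof.
apply: continuous_big => [|i _]; first exact: add_continuous.
exact: coord_continuous.
Qed.

Let exc_cont s : continuous (exc s : _ -> R^o).
Proof.
elim: s => [|S s IH] v.
  have -> : exc [::] = cst 0 by apply/funext => u; rewrite /exc big_nil.
  exact: cst_continuous.
have -> : exc (S :: s) =
    (fun u : 'rV[R]_n => \sum_(i in S) u ord0 i - c S : R^o) \max exc s.
  by apply/funext => u; rewrite /exc big_cons.
apply: continuous_max; last exact: IH.
apply: (@continuousB _ _ _
  (fun u : 'rV[R]_n => \sum_(i in S) u ord0 i : R^o) (cst (c S))).
  exact: (sum_cont (P := fun i => i \in S)).
exact: cst_continuous.
Qed.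

Let E v := exc (index_enum {set 'I_n}) v.

Let excP v z : (E v <= z) <->
  (forall S : {set 'I_n}, \sum_(i in S) v ord0 i <= c S + z).
Proof.
split=> [h S|h].
  rewrite -lerBlDl; apply: le_trans h; rewrite /E /exc.
  exact: (le_bigmax _ (fun S : {set 'I_n} => \sum_(i in S) v ord0 i - c S)).
apply/bigmax_leP; split=> [|S _]; last by rewrite lerBlDl.
by have := h finset.set0; rewrite big_set0 c0 add0r.
Qed.

Let cN := c [set: 'I_n]%SET.
Let eff := [set v : 'rV[R]_n | \sum_i v ord0 i = cN].

Let eff_closed : closed eff.
Proof.
apply: (@preimage_closed _ _ (fun v : 'rV[R]_n => \sum_i v ord0 i : R^o) [set cN]).
  by move=> v _; exact: sum_cont.
exact: closed_eq.
Qed.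

Let eff0 : eff !=set0.
Proof.
case: n c c0 @cN @eff => [|m] c' c0' cN' eff'.
  exists 0; rewrite /eff' /= /cN' big_ord0 -c0'; congr c'.
  by apply/setP => -[].
exists (\row_i if i == ord0 then cN' else 0).
rewrite /eff' /= (bigD1 ord0)//= mxE eqxx big1 ?addr0// => i /negbTE h.
by rewrite mxE h.
Qed.

Let minE : exists2 v, eff v & forall u, eff u -> E v <= E u.
Proof.
have [v0 v0e] := eff0; set M := E v0.
pose lo i := cN - (c (~: [set i])%SET + M); pose hi i := c [set i]%SET + M.
pose box := [set v : 'rV[R]_n | forall i, `[lo i, hi i] (v ord0 i)].
have inbox u : eff u -> E u <= M -> box u.
  move=> ue /excP h i; rewrite /= in_itv /=; apply/andP; split.
    rewrite /lo lerBlDr -ue (bigD1 i)//= lerD2l.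
    by apply: le_trans (h (~: [set i])%SET); rewrite le_eqVlt; apply/orP; left;
      apply/eqP; apply: eq_bigl => j; rewrite !inE.
  by have := h [set i]%SET; rewrite big_set1.
have boxc : compact box.
  by apply: (@rV_compact _ n (fun i => `[lo i, hi i])) => i;
     exact: segment_compact.
have ne : box `&` eff !=set0 by exists v0; split=> //; apply: inbox.
have Ec : {within box `&` eff, continuous E}.
  by apply: continuous_subspaceT => u; exact: exc_cont.
have [v] := EVT_min_rV ne (compact_closedI boxc eff_closed) Ec.
rewrite inE => -[_ ve] vmin; exists v => // u ue.
case: (leP (E u) M) => h; first by apply: vmin; rewrite inE; split=> //; exact: inbox.
apply: le_trans (ltW h); apply: vmin; rewrite inE; split=> //; exact: inbox.
Qed.

Lemma least_core_value_min :
  (exists phi, least_core_feasible c (least_core_value c) phi) /\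
  forall z phi, least_core_feasible c z phi -> least_core_value c <= z.
Proof.
have [v ve vmin] := minE.
have vf : least_core_feasible c (E v) (v ord0) by split; last exact/excP.
have lb z phi : least_core_feasible c z phi -> E v <= z.
  move=> [pe ph]; have re : eff (\row_i phi i).
    by rewrite /eff /= /cN -pe; apply: eq_bigr => i _; rewrite mxE.
  apply: le_trans (vmin _ re) _; apply/excP => S.
  by apply: le_trans (ph S); rewrite le_eqVlt; apply/orP; left; apply/eqP;
    apply: eq_bigr => i _; rewrite mxE.
suff -> : least_core_value c = E v by split=> //; exists (v ord0).
apply/eqP; rewrite eq_le; apply/andP; split.
  by apply: ge_inf; [exists (E v) => z [phi /lb] | exists (v ord0)].
by apply: lb_le_inf; [exists (E v), (v ord0) | move=> z [phi /lb]].
Qed.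

End MinimumAttained.

(* Main.v *)
Require Import Defs.
From mathcomp Require Import all_boot all_classical all_reals.
From mathcomp Require Import all_order all_algebra all_fingroup lra.

Set Implicit Arguments.
Unset Strict Implicit.
Unset Printing Implicit Defensive.

Import Order.TTheory GRing.Theory Num.Theory.

Local Open Scope ring_scope.

(** For the preferences (1,1,2) the allocation (1,1,0) shows that the least
core value is at most 1.  The coalitions omitting car 1 or car 2 cost 0 while
the grand coalition costs 2, so every least core allocation gives at least 1 to
each of the cars 1 and 2, hence at most 0 to car 3.  But car 3 has nonnegative
marginal costs, and a positive one when it comes last, so its Shapley value is
positive. *)

Definition prefs112 : 3.-tuple nat := [tuple 1; 1; 2]%N.

Section Game112.
Variable R : realType.

Let i0 : 'I_3 := ord0.
Let i1 : 'I_3 := lift ord0 ord0.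
Let i2 : 'I_3 := ord_max.

Let game : {set 'I_3} -> R := parking_game R prefs112.

Let ord3_sum (F : 'I_3 -> R) : \sum_i F i = F i0 + F i1 + F i2.
Proof.
rewrite !big_ord_recl big_ord0 addr0 addrA.
by congr (_ + F _); apply: val_inj.
Qed.

Let ord3_sum_in (S : {set 'I_3}) (F : 'I_3 -> R) :
  \sum_(i in S) F i = (if i0 \in S then F i0 else 0) +
    (if i1 \in S then F i1 else 0) + (if i2 \in S then F i2 else 0).
Proof. by rewrite big_mkcond ord3_sum. Qed.

(** The second car preferring spot 1 is pushed to spot 2, at cost 1. Car 3 is displaced, from spot 2
    to spot 3, only when both of those cars are present. *)
Let gameE (S : {set 'I_3}) :
  game S = ((i0 \in S) && (i1 \in S) + [&& i0 \in S, i1 \in S & i2 \in S])%:R.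
Proof.
rewrite /game /parking_game; congr (_%:R).
(* Filtering an explicit list lets the displacement compute in each of the eight cases. *)
have -> : enum S = [seq i <- [:: i0; i1; i2] | i \in S].
  have <- : enum 'I_3 = [:: i0; i1; i2].
    by apply: (inj_map val_inj); rewrite val_enum_ord.
  by rewrite {2}/enum_mem filter_predT.
rewrite /=; case: (i0 \in S); case: (i1 \in S); case: (i2 \in S);
  by rewrite /displacement /= ?big_cons big_nil.
Qed.

Let gameT : game [set: 'I_3]%SET = 2.
Proof. by rewrite gameE !inE. Qed.

Let game_mono (A B : {set 'I_3}) : A \subset B -> game A <= game B.
Proof.
move=> /fintype.subsetP sAB; rewrite !gameE ler_nat.
have leb (b b' : bool) : (b -> b') -> (b <= b')%N by case: b => // ->.
by apply: leq_add; apply: leb;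
  [case/andP=> /sAB -> /sAB -> | case/and3P=> /sAB -> /sAB -> /sAB ->].
Qed.

Lemma least_core_value112_le1 : least_core_value game <= 1.
Proof.
have game0 : game finset.set0 = 0 by rewrite gameE !inE.
have [_ /(_ 1 (fun i => (i != i2)%:R))] := least_core_value_min game0.
apply; split=> [|S]; first by rewrite gameT ord3_sum /= addr0.
rewrite gameE ord3_sum_in /=.
by case: (i0 \in S); case: (i1 \in S); case: (i2 \in S) => /=; lra.
Qed.

Lemma shapley112_gt0 : 0 < shapley game i2.
Proof.
rewrite /shapley mulr_gt0 ?invr_gt0 ?ltr0n//.
(* Under the identity, car 3 comes last and its marginal cost is 2 - 1 = 1. *)
rewrite (bigD1 (1%g : 'S_3)) //= ltr_pwDl//.
  by rewrite !gameE !inE !perm1 /=; lra.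
apply: sumr_ge0 => s _; rewrite subr_ge0; apply: game_mono.
by apply/fintype.subsetP => j; rewrite !inE => /ltnW.
Qed.

Lemma shapley112_notin_least_core : ~ least_core game (shapley game).
Proof.
move=> [eff core].
have := least_core_value112_le1; have := shapley112_gt0.
(* As the least core value is at most 1, these two constraints add up to phi_1 + phi_2 + 2 phi_3 <=
   2, whereas phi_1 + phi_2 + phi_3 = 2; hence phi_3 <= 0. *)
have := core [set~ i0]%SET; have := core [set~ i1]%SET.
rewrite !gameE !ord3_sum_in !inE /=.
move: eff; rewrite gameT ord3_sum; lra.
Qed.

End Game112.

Theorem lemma4p1 (R : realType) :
  exists (n : nat) (alpha : n.-tuple nat),
    (0 < n)%N /\ parking_function n alpha /\
    ~ least_core (parking_game R alpha) (shapley (parking_game R alpha)).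
Proof.
by exists 3%N, prefs112; split=> //; split=> //; exact: shapley112_notin_least_core.
Qed.
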